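(* Let $S = \langle n_1, \ldots, n_k\rangle$ be a numerical semigroup with fixed generators $n_1 < \cdots < n_k$. If $f = \mathsf{M}_S$ (maximum factorization length) or $f = \mathsf{m}_S$ (minimum factorization length), then the dissonance point of $f$ is $d - n_{[k]}$, where $n_{[k]} = n_1 + \cdots + n_k$ and $$d = \deg\bigg(\sum_{n \ge 0} \widehat\chi_f(\Delta_n)\, t^n\bigg).$$
   Context: A numerical semigroup is a subset $S \subseteq \mathbb{Z}_{\ge 0}$ containing $0$, closed under addition, with finite complement; $S = \langle n_1, \ldots, n_k\rangle$ means $S$ is generated by the positive integers $n_1 < \cdots < n_k$ (a fixed generating set). The Frobenius number $\mathsf{F}(S)$ is the largest integer lying in the complement of $S$. For $n \in S$, a factorization of $n$ is $a \in \mathbb{Z}_{\ge 0}^k$ with $n = a_1 n_1 + \cdots + a_k n_k$, and its length is $a_1 + \cdots + a_k$. $\mathsf{M}_S(n)$ and $\mathsf{m}_S(n)$ denote the maximum and minimum lengths of factorizations of $n \in S$, and both are $0$ for $n \in \mathbb{Z}\setminus S$. A function $g:\mathbb{Z}\to\mathbb{R}$ is a quasipolynomial if $g(n) = a_\alpha(n) n^\alpha + \cdots + a_0(n)$ with periodic coefficient functions $a_i$. It is known that for all sufficiently large $n\in S$, $\mathsf{M}_S(n+n_1) = \mathsf{M}_S(n)+1$ and $\mathsf{m}_S(n+n_k) = \mathsf{m}_S(n)+1$, so each of $\mathsf{M}_S$, $\mathsf{m}_S$ agrees with a quasipolynomial for all sufficiently large inputs. If $f$ agrees with the quasipolynomial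 $g:\mathbb{Z} \to \mathbb{R}$ for all sufficiently large inputs, the dissonance point of $f$ is the largest integer $n \ge \mathsf{F}(S)$ such that $f(n) \ne g(n)$. For $F \subseteq [k] = \{1,\ldots,k\}$ put $n_F = \sum_{i \in F} n_i$. The squarefree divisor complex $\Delta_n$ has as faces the $F \subseteq [k]$ (including $F=\emptyset$) with $n - n_F \in S$ (so there are no faces if $n \notin S$). The augmented Euler characteristic is $$\widehat\chi_f(\Delta_n) = \sum_{F \in \Delta_n} (-1)^{|F|} \big(f(n - n_F) + |F|\big),$$ which is $0$ for $n \notin S$. Here $\deg$ denotes the degree in $t$.
   Formalization: If f(n) = g(n) for all n ≥ F(S) (e.g. maximum length on <2,3>), the dissonance point, undefined by the stated definition, is taken to be F(S); the zero series (only for S = <1>, k = 1) is given degree 0. *)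

(* Defs.v *)
From HB Require Import structures.
From mathcomp Require Import all_boot all_order all_algebra.

Set Implicit Arguments.
Unset Strict Implicit.
Unset Printing Implicit Defensive.

Import Order.TTheory GRing.Theory Num.Theory.
Local Open Scope ring_scope.

Definition numerical_semigroup (S : pred int) : Prop :=
  [/\ forall n, S n -> 0 <= n,
      S 0,
      forall m n, S m -> S n -> S (m + n)
    & exists N : int, forall n, N <= n -> S n].

(* The complement is taken in the integers, so that the Frobenius number of
   the semigroup of all nonnegative integers is -1. *)
Definition frobenius_number (S : pred int) (F : int) : Prop :=
  ~~ S F /\ forall n, F < n -> S n.

Section Factorizations.

Variables (k : nat) (gen : 'I_k -> nat).

Definition factorization (n : int) (a : 'I_k -> nat) : bool :=
  n == (\sum_i a i * gen i)%N%:Z.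

Definition flength (a : 'I_k -> nat) : nat := (\sum_i a i)%N.

(* When the generators are positive, every factorization a of n satisfies
   a i <= n, so the candidates may be taken in a finite type; the lemmas from
   factorization_bounded on remove the bound. *)
Definition bounded_tuple (n : int) : finType :=
  {ffun 'I_k -> 'I_(absz n).+1}.

Definition tuple_val (n : int) (a : bounded_tuple n) : 'I_k -> nat :=
  fun i => a i.

Definition generated : pred int := fun n =>
  [exists a : bounded_tuple n, factorization n (tuple_val a)].

Definition max_length (n : int) : nat :=
  \max_(a : bounded_tuple n | factorization n (tuple_val a))
    flength (tuple_val a).

(* Starting the minimum at max_length n does not change it when n has a
   factorization, and gives 0 otherwise. *)
Definition min_length (n : int) : nat :=
  \big[minn/max_length n]_(a : bounded_tuple n
                             | factorization n (tuple_val a))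
    flength (tuple_val a).

Hypothesis gen_gt0 : forall i, (0 < gen i)%N.

Lemma factorization_bounded n (a : 'I_k -> nat) :
  factorization n a -> exists b : bounded_tuple n, tuple_val b =1 a.
Proof.
move=> /eqP fa.
have le_a i : (a i < (absz n).+1)%N.
  rewrite ltnS fa absz_nat (bigD1 i) //=.
  by apply: leq_trans (leq_addr _ _); rewrite leq_pmulr.
by exists [ffun i => Ordinal (le_a i)] => i; rewrite /tuple_val ffunE.
Qed.

Lemma eq_factorization n (a b : 'I_k -> nat) :
  a =1 b -> factorization n a = factorization n b.
Proof.
by move=> eq_ab; congr (_ == Posz _); apply: eq_bigr => i _; rewrite eq_ab.
Qed.

Lemma eq_flength (a b : 'I_k -> nat) : a =1 b -> flength a = flength b.
Proof. by move=> eq_ab; apply: eq_bigr => i _. Qed.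

Lemma generatedP n :
  reflect (exists a : 'I_k -> nat, factorization n a) (generated n).
Proof.
apply: (iffP existsP) => [[a fa]|[a fa]]; first by exists (tuple_val a).
have [b eq_ba] := factorization_bounded fa.
by exists b; rewrite (eq_factorization n eq_ba).
Qed.

Lemma max_length_ge n a : factorization n a -> (flength a <= max_length n)%N.
Proof.
move=> fa; have [b eq_ba] := factorization_bounded fa.
rewrite -(eq_flength eq_ba) /max_length.
by apply: (@leq_bigmax_cond _ _ (fun c => flength (tuple_val c)));
  rewrite (eq_factorization n eq_ba).
Qed.

Lemma max_length_attained n :
  generated n -> exists2 a, factorization n a & flength a = max_length n.
Proof.
move=> /existsP [a0 fa0].
have card_gt0 :
    (0 < #|[pred a : bounded_tuple n | factorization n (tuple_val a)]|)%N.
  by apply/card_gt0P; exists a0.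
have [a fa ea] := eq_bigmax_cond (fun c => flength (tuple_val c)) card_gt0.
by exists (tuple_val a).
Qed.

Lemma max_length_out n : ~~ generated n -> max_length n = 0%N.
Proof.
by move=> /existsPn nf; apply: big_pred0 => a; apply/negbTE/nf.
Qed.

Lemma min_length_le n a : factorization n a -> (min_length n <= flength a)%N.
Proof.
move=> fa; have [b eq_ba] := factorization_bounded fa.
rewrite -(eq_flength eq_ba) /min_length.
have fb : factorization n (tuple_val b) by rewrite (eq_factorization n eq_ba).
have : b \in index_enum (bounded_tuple n) by rewrite mem_index_enum.
elim: (index_enum _) => // c s IHs; rewrite in_cons big_cons.
case: eqVneq => [<- _|_ /= /IHs le_s]; first by rewrite fb geq_minl.
by case: ifP => // _; apply: leq_trans (geq_minr _ _) le_s.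
Qed.

Lemma min_length_attained n :
  generated n -> exists2 a, factorization n a & flength a = min_length n.
Proof.
move=> Sn; rewrite /min_length.
apply: (big_ind (fun m => exists2 a, factorization n a & flength a = m)).
- exact: max_length_attained.
- by move=> x y hx hy; case: (leqP x y).
- by move=> a fa; exists (tuple_val a).
Qed.

Lemma min_length_out n : ~~ generated n -> min_length n = 0%N.
Proof.
move=> nSn; rewrite /min_length big_pred0 ?max_length_out // => a.
by move/existsPn: nSn => nf; apply/negbTE/nf.
Qed.

Definition gen_sum (F : {set 'I_k}) : nat := (\sum_(i in F) gen i)%N.

Definition sqfree_divisor_complex (n : int) : {set {set 'I_k}} :=
  [set F : {set 'I_k} | generated (n - (gen_sum F)%:Z)].

Definition aug_euler_char (R : pzRingType) (f : int -> R) (n : int) : R :=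
  \sum_(F in sqfree_divisor_complex n)
     (-1) ^+ #|F| * (f (n - (gen_sum F)%:Z) + #|F|%:R).

End Factorizations.

Definition periodic (T : Type) (a : int -> T) : Prop :=
  exists2 p : nat, (0 < p)%N & forall n, a (n + p%:Z) = a n.

Definition quasipolynomial (R : pzRingType) (g : int -> R) : Prop :=
  exists (alpha : nat) (a : nat -> int -> R),
    (forall i, (i <= alpha)%N -> periodic (a i)) /\
    forall n : int, g n = \sum_(i < alpha.+1) a i n * n%:~R ^+ i.

Definition eventually_equal (T : Type) (f g : int -> T) : Prop :=
  exists N : int, forall n, N <= n -> f n = g n.

(* m is the largest integer n >= F with f n <> g n, where g is the
   quasipolynomial that f eventually agrees with (two quasipolynomials that
   agree on all large integers are equal, so g is unique). If f and g agree on
   all of [F, +oo), there is no such n and the dissonance point is F: this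
   happens for the maximum length on <2, 3>, where both are n |-> floor (n / 2)
   on n >= 0 and F = 1. *)
Definition dissonance_point (R : pzRingType) (F : int) (f : int -> R)
    (m : int) : Prop :=
  exists g : int -> R,
    [/\ quasipolynomial g, eventually_equal f g
      & [/\ F <= m, f m <> g m & forall n, m < n -> f n = g n]
        \/ (m = F /\ forall n, F <= n -> f n = g n)].

(* The zero polynomial gets degree 0. With this value the formula for the
   dissonance point also holds for S = <1> with k = 1, the only case in which
   the generating function of the Euler characteristics vanishes. *)
Definition degree (R : nzRingType) (p : {poly R}) : nat := (size p).-1.

(* Main.v *)
(* Let p be the smallest generator for the maximum length, the largest one for
   the minimum length. In an extremal factorization every other generator n_j
   occurs fewer than p times, since p copies of n_j could be exchanged for n_j
   copies of p; hence f (n + p) = f n + 1 for large n, and f agrees eventually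
   with a quasipolynomial g such that g (n + p) = g n + 1 for all n. Pairing
   the sets F with and without the index of p gives
   sum_F (-1)^|F| (g (n - n_F) + |F|) = 0 over all F, so the Euler
   characteristic at n is an alternating sum of errors at the points n - n_F.
   The errors vanish above the dissonance point m, so the sum vanishes for
   n > m + n_[k], and at n = m + n_[k] only F = [k] contributes. That term is
   nonzero, except on <1>, where m + n_[k] = 0. *)

Require Import Defs.
From mathcomp Require Import all_boot all_order all_algebra.
From mathcomp Require Import zify.

Import Order.TTheory GRing.Theory Num.Theory.
Local Open Scope ring_scope.

(** * Exchanging generators inside factorizations *)

(** Weights [gen] compare values, weights 1 compare lengths. Terms are added on both sides to avoid
    truncated subtraction. *)
Lemma sum_transfer (k : nat) (a b w : 'I_k -> nat) (i j : 'I_k) (s t : nat) :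
  (forall x, b x + (x == j) * s = a x + (x == i) * t)%N ->
  (\sum_x b x * w x + s * w j = \sum_x a x * w x + t * w i)%N.
Proof.
move=> eq_ba.
have delta y u : (\sum_x (x == y) * u * w x = u * w y)%N.
  rewrite (bigD1 y) //= eqxx mul1n big1 ?addn0 // => x /negbTE->.
  by rewrite !mul0n.
rewrite -(delta j s) -(delta i t) -!big_split /=.
by apply: eq_bigr => x _; rewrite -!mulnDl eq_ba.
Qed.

Lemma flength_transfer (k : nat) (a b : 'I_k -> nat) (i j : 'I_k) (s t : nat) :
  (forall x, b x + (x == j) * s = a x + (x == i) * t)%N ->
  (flength b + s = flength a + t)%N.
Proof.
move=> eq_ba; have len_sum (c : 'I_k -> nat) : (\sum_x c x * 1 = flength c)%N.
  by apply: eq_bigr => x _; rewrite muln1.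
have := sum_transfer _ _ _ (fun=> 1%N) _ _ _ _ eq_ba.
by rewrite /= !len_sum !muln1.
Qed.

Lemma factorization_exchange (k : nat) (gen a : 'I_k -> nat) (n : int)
    (i j : 'I_k) :
  factorization gen n a -> j != i -> (gen i <= a j)%N ->
  exists2 b, factorization gen n b
    & (flength b + gen i = flength a + gen j)%N.
Proof.
move=> /eqP fa ji le_ij.
pose b x := (a x + (x == i) * gen j - (x == j) * gen i)%N.
have eq_ba x : (b x + (x == j) * gen i = a x + (x == i) * gen j)%N.
  by rewrite /b subnK //; case: (eqVneq x j) => [->|_]; lia.
exists b; last exact: flength_transfer eq_ba.
by apply/eqP; have := sum_transfer _ _ _ gen _ _ _ _ eq_ba; lia.
Qed.

Lemma factorization_add (k : nat) (gen b : 'I_k -> nat) (n : int) (i : 'I_k) :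
  factorization gen n b ->
  exists2 a, factorization gen (n + (gen i)%:Z) a & flength a = (flength b).+1.
Proof.
move=> /eqP fb; pose a x := (b x + (x == i))%N.
have eq_ab x : (a x + (x == i) * 0 = b x + (x == i) * 1)%N by rewrite /a; lia.
exists a; last by have := flength_transfer _ _ _ _ _ _ _ eq_ab; lia.
by apply/eqP; have := sum_transfer _ _ _ gen _ _ _ _ eq_ab; lia.
Qed.

(** If [a i] were 0, the small coefficients would bound the value by [gen i * gen_sum gen setT],
    which is less than [n + gen i]. *)
Lemma factorization_remove (k : nat) (gen a : 'I_k -> nat) (n : int)
    (i : 'I_k) :
  (0 < gen i)%N -> ((gen i * gen_sum gen setT)%N%:Z <= n) ->
  factorization gen (n + (gen i)%:Z) a ->
  (forall j, j != i -> (a j < gen i)%N) ->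
  exists2 b, factorization gen n b & flength a = (flength b).+1.
Proof.
move=> gi0 le_n /eqP fa small.
have ai0 : (0 < a i)%N.
  rewrite lt0n; apply/eqP => ai0.
  have : (\sum_x a x * gen x <= gen i * gen_sum gen setT)%N.
    rewrite /gen_sum big_distrr /= [leqRHS](eq_bigl xpredT) => [|x]; last first.
      by rewrite inE.
    apply: leq_sum => x _; rewrite leq_mul2r; case: (eqVneq x i) => [->|xi].
      by rewrite ai0 orbT.
    by rewrite ltnW ?orbT ?small.
  by lia.
pose b x := (a x - (x == i))%N.
have eq_ba x : (b x + (x == i) * 1 = a x + (x == i) * 0)%N.
  by rewrite /b; case: eqVneq => [->|_]; lia.
exists b; last by have := flength_transfer _ _ _ _ _ _ _ eq_ba; lia.
by apply/eqP; have := sum_transfer _ _ _ gen _ _ _ _ eq_ba; lia.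
Qed.

(** * Recursions for the extremal lengths *)

Lemma max_length_step (k : nat) (gen : 'I_k -> nat) (n : int) (i : 'I_k) :
  (forall j, 0 < gen j)%N -> (forall j, j != i -> gen i < gen j)%N ->
  generated gen n -> ((gen i * gen_sum gen setT)%N%:Z <= n) ->
  max_length gen (n + (gen i)%:Z) = (max_length gen n).+1.
Proof.
move=> gen_gt0 min_i Sn le_n; apply/eqP; rewrite eqn_leq; apply/andP; split.
  have [b fb lb] := max_length_attained Sn.
  have [a0 fa0 _] := factorization_add _ _ _ _ i fb.
  have [|a fa la] := max_length_attained (gen := gen) (n := n + (gen i)%:Z).
    by apply/generatedP => //; exists a0.
  have [|c fc lc] := factorization_remove _ _ _ _ _ (gen_gt0 i) le_n fa.
    (* Exchanging copies of a larger generator for the smallest one would lengthen the maximal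
       [a]. *)
    move=> j ji; rewrite ltnNge; apply/negP => le_ij.
    have [c fc lc] := factorization_exchange _ _ _ _ _ _ fa ji le_ij.
    by have := max_length_ge gen_gt0 fc; have := min_i _ ji; lia.
  by rewrite -la lc ltnS; apply: max_length_ge.
have [b fb <-] := max_length_attained Sn.
have [a fa <-] := factorization_add _ _ _ _ i fb.
exact: max_length_ge.
Qed.

Lemma min_length_step (k : nat) (gen : 'I_k -> nat) (n : int) (i : 'I_k) :
  (forall j, 0 < gen j)%N -> (forall j, j != i -> gen j < gen i)%N ->
  generated gen n -> ((gen i * gen_sum gen setT)%N%:Z <= n) ->
  min_length gen (n + (gen i)%:Z) = (min_length gen n).+1.
Proof.
move=> gen_gt0 max_i Sn le_n; apply/eqP; rewrite eqn_leq; apply/andP; split.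
  have [b fb <-] := min_length_attained Sn.
  have [a fa <-] := factorization_add _ _ _ _ i fb.
  exact: min_length_le.
have [b fb lb] := min_length_attained Sn.
have [a0 fa0 _] := factorization_add _ _ _ _ i fb.
have [|a fa la] := min_length_attained (gen := gen) (n := n + (gen i)%:Z).
  by apply/generatedP => //; exists a0.
have [|c fc lc] := factorization_remove _ _ _ _ _ (gen_gt0 i) le_n fa.
  (* Here the exchange goes towards the largest generator and would shorten the minimal [a]. *)
  move=> j ji; rewrite ltnNge; apply/negP => le_ij.
  have [c fc lc] := factorization_exchange _ _ _ _ _ _ fa ji le_ij.
  by have := min_length_le gen_gt0 fc; have := max_i _ ji; lia.
by rewrite -la lc ltnS; apply: min_length_le.
Qed.

(** * The quasipolynomial and the last error *)

Lemma quasilinear_extension (R : numFieldType) (f : int -> R) (p : nat)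
    (N : int) :
  (0 < p)%N -> (forall n, N <= n -> f (n + p%:Z) = f n + 1) ->
  exists g : int -> R,
    [/\ quasipolynomial g, forall n, g (n + p%:Z) = g n + 1
      & forall n, N <= n -> f n = g n].
Proof.
move=> p0 step.
have steps t n : N <= n -> f (n + (t * p)%N%:Z) = f n + t%:R.
  move=> le_n; elim: t => [|t IHt]; first by rewrite mul0n !addr0.
  have -> : n + (t.+1 * p)%N%:Z = n + (t * p)%N%:Z + p%:Z by lia.
  by rewrite step ?IHt ?natr1 -?addrA ?natr1 //; lia.
(* Any number of steps of size p that lands above N would do. *)
pose g n := let t := (absz N + absz n)%N in f (n + (t * p)%N%:Z) - t%:R.
have gE t n : N <= n + (t * p)%N%:Z -> g n = f (n + (t * p)%N%:Z) - t%:R.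
  rewrite /g; set s := (_ + _)%N => le_t.
  have le_s : N <= n + (s * p)%N%:Z.
    have : (s <= s * p)%N by rewrite leq_pmulr.
    by rewrite /s; lia.
  (* The values after [s] and after [t] steps are compared at the common point reached after [s + t]
     steps. *)
  have := steps s _ le_t; have := steps t _ le_s.
  have -> : n + (t * p)%N%:Z + (s * p)%N%:Z = n + (s * p)%N%:Z + (t * p)%N%:Z.
    by lia.
  by move=> -> e; apply/eqP; rewrite subr_eq addrAC eq_sym subr_eq -e.
have gS n : g (n + p%:Z) = g n + 1.
  pose t := (absz N + absz n)%N.
  have le_t : N <= n + (t * p)%N%:Z.
    have : (t <= t * p)%N by rewrite leq_pmulr.
    by rewrite /t; lia.
  have e : n + p%:Z + (t * p)%N%:Z = n + (t * p)%N%:Z + p%:Z by lia.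
  by rewrite (gE t n) // (gE t) e ?step //; [rewrite addrAC | lia].
exists g; split => //; last first.
  by move=> n le_n; rewrite (gE 0%N) mul0n !addr0 ?subr0.
have pR : p%:R != 0 :> R by rewrite pnatr_eq0 -lt0n.
(* The slope 1 / [p] is constant, and [g n - n / p] has period [p] because both terms grow by 1 over
   a step [p]. *)
exists 1%N, (fun i n => if i == 0%N then g n - n%:~R / p%:R else p%:R^-1).
split=> [i _ | n].
  exists p => // n; case: ifP => // _; rewrite gS intrD mulrDl.
  by rewrite -pmulrn divff // opprD addrACA subrr addr0.
by rewrite big_ord_recl big_ord1 /= expr0 expr1 mulr1 [X in _ + X]mulrC subrK.
Qed.

Lemma last_nonzero_above (R : pzRingType) (e : int -> R) (F N : int) :
  (forall n, N <= n -> e n = 0) ->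
  exists m, [/\ F <= m, forall n, m < n -> e n = 0 & m = F \/ e m != 0].
Proof.
move=> e0; suff : forall d : nat, (forall n, F + d%:Z < n -> e n = 0) ->
    exists m, [/\ F <= m, forall n, m < n -> e n = 0 & m = F \/ e m != 0].
  by move=> /(_ `|N - F|%N); apply=> n lt_n; apply: e0; lia.
elim=> [|d IHd] ed.
  by exists F; split=> [//|n lt_n|]; [apply: ed; lia | left].
have [ed0|edn0] := eqVneq (e (F + d.+1%:Z)) 0; last first.
  by exists (F + d.+1%:Z); split=> //; [lia | right].
apply: IHd => n lt_n; have [->//|ne] := eqVneq n (F + d.+1%:Z).
by apply: ed; lia.
Qed.

(** * Alternating sums over sets of generators *)

Lemma alternating_sum_quasilinear (R : comPzRingType) (k : nat)
    (gen : 'I_k -> nat) (i : 'I_k) (g : int -> R) (n : int) :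
  (forall n, g (n + (gen i)%:Z) = g n + 1) ->
  \sum_(F : {set 'I_k}) (-1) ^+ #|F| * (g (n - (gen_sum gen F)%:Z) + #|F|%:R)
    = 0.
Proof.
move=> gS; rewrite (bigID (fun F : {set 'I_k} => i \in F)) /=.
rewrite (reindex_onto (fun F => i |: F) (fun F => F :\ i)) /=; last first.
  by move=> F iF; rewrite setD1K.
rewrite [X in X + _](eq_bigl (fun F : {set _} => i \notin F)); last first.
  move=> F; rewrite setU11 /=; apply/eqP/idP => [<-|iF].
    by rewrite setD11.
  exact: setU1K.
rewrite -big_split big1 //= => F iF.
rewrite cardsU1 iF /= add1n exprS mulN1r mulNr.
(* Adjoining [i] lowers [g] by 1 and raises the cardinality by 1, so the paired terms differ only in
   sign. *)
have -> : g (n - (gen_sum gen F)%:Z) = g (n - (gen_sum gen (i |: F))%:Z) + 1.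
  rewrite -gS; congr g; rewrite /gen_sum big_setU1 //=; lia.
by rewrite -natr1 addrAC -addrA addNr.
Qed.

Lemma gen_sumT (k : nat) (gen : 'I_k -> nat) (F : {set 'I_k}) :
  (forall i, 0 < gen i)%N -> F != setT ->
  (gen_sum gen F < gen_sum gen setT)%N.
Proof.
move=> gen_gt0 FT; have [i iF] : exists i, i \notin F.
  apply/existsP; rewrite -negb_forall; apply: contra FT => /forallP hF.
  by apply/eqP/setP => x; rewrite hF inE.
rewrite /gen_sum [ltnRHS](bigID (mem F)) /=.
rewrite (eq_bigl (mem F)) => [|x]; last by [].
rewrite [X in (_ < X + _)%N](eq_bigl (mem F)) => [|x]; last by rewrite inE.
by rewrite -[ltnLHS]addn0 ltn_add2l (bigD1 i) ?inE ?iF //= addn_gt0 gen_gt0.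
Qed.

Lemma aug_euler_char_error (R : comPzRingType) (k : nat) (gen : 'I_k -> nat)
    (i : 'I_k) (f g : int -> R) (n : int) :
  (forall n, g (n + (gen i)%:Z) = g n + 1) ->
  aug_euler_char gen f n =
  \sum_(F : {set 'I_k}) (-1) ^+ #|F| *
    let x := n - (gen_sum gen F)%:Z in
    ((if generated gen x then f x + #|F|%:R else 0) - (g x + #|F|%:R)).
Proof.
move=> gS; rewrite -[LHS]subr0.
rewrite -[X in _ - X](alternating_sum_quasilinear _ _ _ i g n gS).
rewrite /aug_euler_char big_mkcond -sumrB; apply: eq_bigr => F _ /=.
by rewrite inE mulrBr; case: ifP => // _; rewrite mulr0.
Qed.

(** * From the last error to the degree *)

Lemma dissonance_of_length (R : realFieldType) (k : nat) (gen : 'I_k -> nat)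
    (i : 'I_k) (len : int -> nat) (N Frob : int) :
  (forall j, 0 < gen j)%N ->
  numerical_semigroup (generated gen) ->
  frobenius_number (generated gen) Frob ->
  (forall n, ~~ generated gen n -> len n = 0%N) ->
  (forall n, generated gen n ->
     exists2 a, factorization gen n a & flength a = len n) ->
  (forall n, N <= n -> len (n + (gen i)%:Z) = (len n).+1) ->
  let f n := (len n)%:R : R in
  exists p : {poly R},
    (forall n : nat, p`_n = aug_euler_char gen f n%:Z) /\
    dissonance_point Frob f ((degree p)%:Z - (gen_sum gen [set: 'I_k])%:Z).
Proof.
move=> gen_gt0 [S_ge0 _ _ _] [SF S_above] len_out len_att len_step f.
have [|g [g_qp gS fg]] := quasilinear_extension R f (gen i) N (gen_gt0 i).
  by move=> n /len_step; rewrite /f => ->; rewrite natr1.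
have [|m [le_Fm e0 m_last]] := last_nonzero_above R (fun n => f n - g n) Frob N.
  by move=> n /fg->; rewrite subrr.
have {}e0 n : m < n -> f n = g n by move=> /e0/eqP; rewrite subr_eq0 => /eqP.
set T := gen_sum gen setT.
have le_iT : (gen i <= T)%N by rewrite /T /gen_sum (bigD1 i) ?inE //= leq_addr.
(* Together with [T >= 1] this makes [m + T] nonnegative, so it can be a degree. *)
have F_ge : -1 <= Frob.
  by rewrite leNgt; apply/negP => /S_above/S_ge0; lia.
pose chi n := aug_euler_char gen f n.
have err0 (c : R) x : m < x ->
    (if generated gen x then f x + c else 0) - (g x + c) = 0.
  by move=> lt_x; rewrite S_above ?e0 ?subrr //; lia.
have chi0 n : m + T%:Z < n -> chi n = 0.
  move=> lt_n; rewrite /chi (aug_euler_char_error _ _ _ i f g n gS).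
  apply: big1 => F _ /=; rewrite err0 ?mulr0 //.
  have : (gen_sum gen F <= T)%N.
    by have [->//|/(gen_sumT _ _ _ gen_gt0)/ltnW] := eqVneq F setT.
  by lia.
have chi_top : chi (m + T%:Z) = (-1) ^+ k *
    ((if generated gen m then f m + k%:R else 0) - (g m + k%:R)).
  rewrite /chi (aug_euler_char_error _ _ _ i f g _ gS) (bigD1 setT) //= big1.
    by rewrite addr0 cardsT card_ord addrK.
  move=> F FT; rewrite err0 ?mulr0 //.
  by have := gen_sumT _ _ _ gen_gt0 FT; rewrite -/T; lia.
have top_nz : chi (m + T%:Z) != 0 \/ m + T%:Z = 0.
  rewrite chi_top; have [mF|mF] := eqVneq m Frob; last first.
    left; case: m_last => [mF'|e_nz]; first by rewrite mF' eqxx in mF.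
    have Sm : generated gen m by apply: S_above; lia.
    rewrite Sm mulf_neq0 ?signr_eq0 //.
    by rewrite opprD addrACA subrr addr0.
  (* At [Frob] the full set is not a face, so the term is, up to sign, [g Frob + k], that is
     [len (Frob + gen i) + k - 1]. *)
  rewrite mF (negbTE SF) sub0r.
  have Sx : generated gen (Frob + (gen i)%:Z).
    by apply: S_above; have := gen_gt0 i; lia.
  have gF : g Frob = (len (Frob + (gen i)%:Z))%:R - 1.
    apply/eqP; rewrite eq_sym subr_eq -gS -e0 //.
    by have := gen_gt0 i; lia.
  have k0 : (0 < k)%N := leq_ltn_trans (leq0n i) (ltn_ord i).
  have [big|] := ltnP 1 (len (Frob + (gen i)%:Z) + k).
    left; rewrite mulf_neq0 ?signr_eq0 // oppr_eq0 gF addrAC -natrD.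
    by rewrite subr_eq0 pnatr_eq1; lia.
  (* The term can vanish only for [k = 1] and length 0; then [Frob + gen i] is 0 and [T] is
     [gen i]. *)
  move=> le1; right; have k1 : k = 1%N by lia.
  have len0 : len (Frob + (gen i)%:Z) = 0%N by lia.
  have [a /eqP fa la] := len_att _ Sx.
  have : (\sum_j a j * gen j = 0)%N.
    apply: big1 => j _; move: la; rewrite len0 => /eqP; rewrite sum_nat_eq0.
    by move=> /forallP/(_ j)/eqP ->.
  have -> : T = gen i.
    rewrite /T /gen_sum (bigD1 i) ?inE //= big1 ?addn0 // => j /andP[_].
    case/eqP; apply: val_inj => /=.
    by have := ltn_ord i; have := ltn_ord j; lia.
  by lia.
pose D := absz (m + T%:Z).
have DE : D%:Z = m + T%:Z by rewrite /D; have := gen_gt0 i; lia.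
exists (\poly_(n < D.+1) chi n%:Z); split.
  move=> n; rewrite coef_poly; case: ltnP => // lt_n.
  by rewrite -[RHS]/(chi n%:Z) chi0 //; lia.
have -> : (degree (\poly_(n < D.+1) chi n%:Z))%:Z - T%:Z = m.
  suff -> : degree (\poly_(n < D.+1) chi n%:Z) = D by lia.
  rewrite /degree; case: top_nz => [nz|z].
    by rewrite size_poly_eq //= DE.
  (* Now [D] is 0, so the size is at most 1 and the degree is 0 even for the zero polynomial. *)
  have := size_poly D.+1 (fun n => chi n%:Z).
  move: (size _) => s; lia.
exists g; split=> //; first by exists N.
have [eq_m|ne_m] := eqVneq (f m) (g m); last first.
  by left; split=> //; apply/eqP.
right.
have mF : m = Frob by case: m_last => //; rewrite eq_m subrr eqxx.
split=> // n; rewrite -mF le_eqVlt => /predU1P[<-//|]; exact: e0.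
Qed.

Theorem theorem4p4 (R : realFieldType) (k : nat) (gen : 'I_k -> nat)
  (gen_gt0 : forall i : 'I_k, (0 < gen i)%N)
  (gen_increasing : forall i j : 'I_k, (i < j)%N -> (gen i < gen j)%N)
  (S_numerical : numerical_semigroup (generated gen))
  (Frob : int) (Frob_S : frobenius_number (generated gen) Frob)
  (f : int -> R)
  (f_length : f = (fun n : int => (max_length gen n)%:R) \/
              f = (fun n : int => (min_length gen n)%:R)) :
  exists p : {poly R},
    (forall n : nat, p`_n = aug_euler_char gen f n%:Z) /\
    dissonance_point Frob f ((degree p)%:Z - (gen_sum gen [set: 'I_k])%:Z).
Proof.
have [_ _ _ [N SN]] := S_numerical.
case: k gen => [|k] gen
  in gen_gt0 gen_increasing S_numerical Frob_S f_length SN *.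
  (* Without generators only 0 has a factorization, yet every integer above [N] must have one. *)
  have /generatedP [//|a] : generated gen ((absz N).+1)%:Z by apply: SN; lia.
  by rewrite /factorization big_ord0.
case: f_length => ->.
  (* Above [B] every integer lies in the semigroup and is large enough for a copy of the generator
     to be removed. *)
  pose B := Num.max N (gen ord0 * gen_sum gen setT)%N%:Z.
  apply: (dissonance_of_length _ _ _ ord0 _ B) => //.
  - by move=> n; apply: max_length_out.
  - by move=> n; apply: max_length_attained.
  move=> n; rewrite ge_max => /andP[/SN Sn le_n].
  apply: max_length_step => // j j0; apply: gen_increasing.
  by rewrite lt0n.
pose B := Num.max N (gen ord_max * gen_sum gen setT)%N%:Z.
apply: (dissonance_of_length _ _ _ ord_max _ B) => //.
- by move=> n; apply: min_length_out.
- by move=> n; apply: min_length_attained.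
move=> n; rewrite ge_max => /andP[/SN Sn le_n].
apply: min_length_step => // j jmax; apply: gen_increasing.
by rewrite ltn_neqAle jmax -ltnS ltn_ord.
Qed.
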